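(* Let $C_1,C_2,\ldots$ be a sequence of convex bodies in $\mathbb{R}^n$ converging to a convex body $C$ in the metric space of closed convex subsets of $\mathbb{R}^n$ equipped with the Hausdorff metric. Let $X_1,X_2,\ldots$ be a sequence of closed sets in $\mathbb{R}^n$ converging to a set $X$ such that the sequence $\mathbf{B}_{C_i}^+(X_i)$ also converges, to some set $K$. Assume that $\operatorname{int}K\ne\emptyset$ or $\operatorname{int}(\mathbf{B}_C^+(X))\neq\emptyset$. Then $K=\mathbf{B}_C^+(X)$.
   Context: A convex body is a compact convex set with non-empty interior. For a convex body $C\subset\mathbb{R}^n$ and a nonempty $X\subseteq\mathbb{R}^n$, $\mathbf{B}_C^+(X)=\bigcap_{v\in X}(C+v)$, and $\mathbf{B}_C^+(\emptyset)=\mathbb{R}^n$. Convergence of sets is with respect to the Hausdorff metric on (nonempty) closed subsets of $\mathbb{R}^n$. *)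

(* Defs.v *)
From mathcomp Require Import all_boot all_order all_algebra.
From mathcomp Require Import all_classical all_reals all_analysis.

Set Implicit Arguments.
Unset Strict Implicit.
Unset Printing Implicit Defensive.

Import Order.TTheory GRing.Theory Num.Theory.
Import numFieldNormedType.Exports.

Local Open Scope classical_set_scope.
Local Open Scope ring_scope.

Section Defs.
Context {R : realType} {n : nat}.
Implicit Types (A B C X : set 'rV[R]_n) (x y : 'rV[R]_n).

Definition convex_body C : Prop :=
  [/\ compact C, convex_set C & interior C !=set0].

(* [B_C^+(X)], the intersection of the translates [C + v] for [v] in [X];
   the intersection over the empty family is the whole space. *)
Definition Bplus C X : set 'rV[R]_n :=
  \bigcap_(v in X) [set c + v | c in C].

(* The library norm on row vectors is the sup norm, hence this definition. *)
Definition euclid_dist x y : R := Num.sqrt (\sum_(j < n) (x 0 j - y 0 j) ^+ 2).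

Definition dist_to_set x A : \bar R :=
  ereal_inf [set (euclid_dist x a)%:E | a in A].

(* Meaningful for nonempty sets; it may be [+oo] when one of them is unbounded. *)
Definition hausdorff_dist A B : \bar R :=
  Order.max (ereal_sup [set dist_to_set a B | a in A])
            (ereal_sup [set dist_to_set b A | b in B]).

(* Convergence in the space of nonempty closed subsets of R^n: the terms and
   the limit are points of that space. *)
Definition hausdorff_cvg (A_ : nat -> set 'rV[R]_n) (L : set 'rV[R]_n) : Prop :=
  [/\ forall i, closed (A_ i) /\ A_ i !=set0,
      closed L /\ L !=set0 &
      hausdorff_dist (A_ i) L @[i --> \oo] --> 0%E].

End Defs.

(* Main.v *)
(** Membership in [Bplus C X] means [p - x \in C] for all [x \in X], so [K] is
    contained in [Bplus C X] by passing to the limit.  Conversely, a point [p]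
    around which a ball fits in [Bplus C X] satisfies [ball (p - x) r `<=` C],
    uniformly in [x \in X]; Rådström's cancellation turns
    [ball (p - x) r `<=` C_ i + ball 0 e] into [p - x_i \in C_ i], hence [p]
    belongs to [Bplus (C_ i) (X_ i)] for large [i] and therefore to [K].  A
    convex set with an interior point lies in the closure of its interior,
    which covers the remaining points. *)

Require Import Defs.
From mathcomp Require Import all_boot all_order all_algebra.
From mathcomp Require Import all_classical all_reals all_analysis.
From mathcomp Require Import ring lra.

Import Order.TTheory GRing.Theory Num.Theory.
Import numFieldNormedType.Exports.
Local Open Scope classical_set_scope.
Local Open Scope ring_scope.

Lemma closed_approx {R : realType} {V : normedModType R} {A : set V} {x : V} :
  closed A -> (forall e, 0 < e -> exists2 a, A a & `|x - a| < e) -> A x.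
Proof.
move=> clA xA; rewrite (closure_id A).1// => B /nbhs_ballP[e /= e0 xB].
have [a Aa xa] := xA e e0; exists a; split => //.
by apply: xB; rewrite -ball_normE.
Qed.

Lemma convex_setP {R : realType} {V : normedModType R} {A : set V} (s : R)
    {x y : V} : convex_set A -> 0 <= s <= 1 -> A x -> A y ->
  A (s *: x + (1 - s) *: y).
Proof.
move=> cA /andP[s0 s1] /mem_set Ax /mem_set Ay.
exact/set_mem/(cA _ _ (Itv01 s0 s1) Ax Ay).
Qed.

(* If [c \in D] is at distance [d] from [y], a point of [D] close to the point
   at distance [t] from [y] on the ray from [c] through [y] gives, by convexity,
   a point of [D] at distance at most [d / 2] from [y]. *)
Lemma convex_cancel {R : realType} {V : normedModType R} {D : set V} {y : V}
    {t : R} : closed D -> convex_set D -> 0 < t ->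
  (forall w, `|y - w| <= t -> exists2 d, D d & `|w - d| < t / 2) -> D y.
Proof.
move=> clD cD t0 yD.
have halve c : D c -> exists2 c', D c' & `|y - c'| <= `|y - c| / 2.
  move=> Dc; have [->|yc] := eqVneq y c.
    by exists c; rewrite // subrr normr0 mul0r.
  have d0 : 0 < `|y - c| by rewrite normr_gt0 subr_eq0.
  set d := `|y - c| in d0 *.
  have dt0 : d + t != 0 by rewrite gt_eqF// addr_gt0.
  pose w := y + (t / d) *: (y - c).
  have [|c'' Dc'' wc''] := yD w.
    rewrite opprD addNKr normrN normrZ -/d.
    by rewrite gtr0_norm ?divr_gt0// divfK ?gt_eqF.
  (* This weight makes [l *: w + (1 - l) *: c] equal to [y]. Replacing [w] by [c''] costs less than
     [l * (t / 2)], which is at most [d / 2]. *)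
  pose l := d / (d + t).
  have l0 : 0 <= l by apply: divr_ge0; [exact: ltW|rewrite ltW// addr_gt0].
  have l1 : l <= 1 by rewrite ler_pdivrMr ?addr_gt0// mul1r lerDl ltW.
  exists (l *: c'' + (1 - l) *: c); first by apply: convex_setP; rewrite ?l0.
  have -> : y - (l *: c'' + (1 - l) *: c) = l *: (w - c'').
    have E : l *: w = l *: y + (1 - l) *: (y - c).
      rewrite scalerDr scalerA; congr (_ + _ *: _); rewrite /l; field.
      by rewrite dt0 gt_eqF.
    rewrite [RHS]scalerBr E scalerBr addrA -scalerDl subrKC scale1r.
    by rewrite opprD addrA addrAC.
  rewrite normrZ ger0_norm//.
  apply: (le_trans (ler_wpM2l l0 (ltW wc''))).
  rewrite mulrA ler_pM2r ?invr_gt0// /l mulrAC ler_pdivrMr ?addr_gt0//.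
  by rewrite ler_pM2l// lerDr ltW.
have [c Dc _] : exists2 d, D d & `|y - d| < t / 2.
  by apply: yD; rewrite subrr normr0 ltW.
have iter_halve k : exists2 c', D c' & `|y - c'| <= `|y - c| / 2 ^+ k.
  elim: k => [|k [c' Dc' yc']]; first by exists c; rewrite ?expr0 ?divr1.
  have [c'' Dc'' yc''] := halve _ Dc'; exists c'' => //.
  apply: (le_trans yc''); rewrite exprSr invfM mulrA.
  by rewrite ler_wpM2r// invr_ge0.
apply: (closed_approx clD) => e e0.
have : `|y - c| / 2 ^+ k @[k --> \oo] --> (0 : R).
  rewrite -[X in _ --> X](mulr0 `|y - c|); apply: cvgMr.
  under eq_fun do rewrite -exprVn.
  by apply: cvg_expr; rewrite gtr0_norm ?invr_gt0// invf_lt1// ltr1n.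
move=> /cvgrPdist_lt/(_ _ e0)[k _ /(_ k (leqnn k))].
rewrite sub0r normrN => /(le_lt_trans (ler_norm _)) ke.
have [c' Dc' yc'] := iter_halve k; exists c' => //.
exact: le_lt_trans ke.
Qed.

(** Hausdorff convergence enters only as a hypothesis, so this one-sided comparison suffices to work
    in the sup norm from here on. *)
Lemma norm_le_euclid_dist {R : realType} {n : nat} (x y : 'rV[R]_n) :
  `|x - y| <= euclid_dist x y.
Proof.
rewrite [leLHS]/Num.norm /= mx_normrE; apply: bigmax_le; first exact: sqrtr_ge0.
move=> [i j] _ /=; rewrite ord1 !mxE -sqrtr_sqr ler_sqrt; last first.
  by apply: sumr_ge0 => k _; exact: sqr_ge0.
by rewrite (bigD1 j)//= lerDl sumr_ge0// => k _; exact: sqr_ge0.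
Qed.

Lemma dist_to_set_approx {R : realType} {n : nat} {x : 'rV[R]_n} {A : set 'rV_n}
    {e : R} : (dist_to_set x A < e%:E)%E -> exists2 a, A a & `|x - a| < e.
Proof.
move=> /ereal_inf_lt[_ [a Aa <-]]; rewrite lte_fin => xa; exists a => //.
exact: le_lt_trans (norm_le_euclid_dist x a) xa.
Qed.

Lemma hausdorff_cvg_near {R : realType} {n : nat} {A_ : nat -> set 'rV[R]_n}
    {L : set 'rV[R]_n} {e : R} : hausdorff_cvg A_ L -> 0 < e ->
  \forall i \near \oo,
    (forall a, A_ i a -> exists2 b, L b & `|a - b| < e) /\
    (forall b, L b -> exists2 a, A_ i a & `|b - a| < e).
Proof.
move=> [_ _ cvgA] e0.
have : \forall i \near \oo, (hausdorff_dist (A_ i) L < e%:E)%E.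
  by apply: (cvgA [set x | (x < e%:E)%E]); apply: open_ereal_lt';
    rewrite lte_fin.
apply: filterS => i; rewrite /hausdorff_dist gt_max => /andP[AL LA].
split=> [a Aa|b Lb]; apply: dist_to_set_approx.
  by apply: le_lt_trans AL; apply: ereal_sup_ubound; exists a.
by apply: le_lt_trans LA; apply: ereal_sup_ubound; exists b.
Qed.

Lemma BplusP {R : realType} {n : nat} {C X : set 'rV[R]_n} {p : 'rV[R]_n} :
  Bplus C X p <-> forall x, X x -> C (p - x).
Proof.
split=> [Bp x /Bp[c Cc <-]|Cp x Xx]; first by rewrite addrK.
by exists (p - x); [exact: Cp|rewrite subrK].
Qed.

Section LimitOfBplus.
Context {R : realType} {n : nat} {C_ X_ : nat -> set 'rV[R]_n}.
Context {C X K : set 'rV[R]_n}.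
Hypothesis cvgC : hausdorff_cvg C_ C.
Hypothesis cvgX : hausdorff_cvg X_ X.
Hypothesis cvgK : hausdorff_cvg (fun i => Bplus (C_ i) (X_ i)) K.

Lemma lim_Bplus_sub : K `<=` Bplus C X.
Proof.
move=> k Kk; apply/BplusP => x Xx.
have [_ [clC _] _] := cvgC.
apply: (closed_approx clC) => e e0.
(* One third each for moving [k] to [ki], [x] to [xi], and [ki - xi] into [C], all at a single index
   [i]. *)
have e30 : 0 < e / 3 by rewrite divr_gt0.
have [i [[[C_C _] [_ XX_]] [_ KB]]] := filter_ex (filterI (filterI
  (hausdorff_cvg_near cvgC e30) (hausdorff_cvg_near cvgX e30))
  (hausdorff_cvg_near cvgK e30)).
have [ki /BplusP Bki kki] := KB k Kk.
have [xi Xi xxi] := XX_ x Xx.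
have [c Cc kic] := C_C _ (Bki _ Xi).
exists c => //.
have -> : k - x - c = (k - ki) - (x - xi) + (ki - xi - c).
  by apply/rowP => j; rewrite !mxE; ring.
have := ler_normD (k - ki - (x - xi)) (ki - xi - c).
have := ler_normB (k - ki) (x - xi).
lra.
Qed.

Hypothesis hC_ : forall i, convex_body (C_ i).

Lemma inner_Bplus_lim {p : 'rV[R]_n} {r : R} : 0 < r ->
  (forall x w, X x -> `|p - x - w| < r -> C w) -> K p.
Proof.
move=> r0 pC; have [_ [clK _] _] := cvgK.
apply: (closed_approx clK) => e e0.
(* Half of [r] pays for replacing [xi] by [x]; the other half is the radius [t] in [convex_cancel],
   whose tolerance [t / 2] is then [r / 2 / 2]. *)
have r20 : 0 < r / 2 by rewrite divr_gt0.
have r40 : 0 < r / 2 / 2 by rewrite divr_gt0.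
have [i [[[_ CC_] [X_X _]] [BK _]]] := filter_ex (filterI (filterI
  (hausdorff_cvg_near cvgC r40) (hausdorff_cvg_near cvgX r20))
  (hausdorff_cvg_near cvgK e0)).
apply: BK; apply/BplusP => xi Xi.
have [x Xx xix] := X_X _ Xi.
have [clC_ _ _] := cvgC; have [_ cC_ _] := hC_ i.
apply: (convex_cancel (clC_ i).1 cC_ r20) => w pw.
apply: CC_; apply: (pC x) => //.
have -> : p - x - w = (p - xi - w) + (xi - x).
  by apply/rowP => j; rewrite !mxE; ring.
have := ler_normD (p - xi - w) (xi - x).
lra.
Qed.

End LimitOfBplus.

Theorem proposition7p4 (R : realType) (n : nat)
    (C_ : nat -> set 'rV[R]_n) (C : set 'rV[R]_n)
    (X_ : nat -> set 'rV[R]_n) (X K : set 'rV[R]_n)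
    (hC_ : forall i, convex_body (C_ i))
    (hC : convex_body C)
    (cvgC : hausdorff_cvg C_ C)
    (hX_ : forall i, closed (X_ i))
    (cvgX : hausdorff_cvg X_ X)
    (cvgK : hausdorff_cvg (fun i => Bplus (C_ i) (X_ i)) K)
    (hint : interior K !=set0 \/ interior (Bplus C X) !=set0) :
  K = Bplus C X.
Proof.
have KB := lim_Bplus_sub cvgC cvgX cvgK.
apply/seteqP; split=> // p /BplusP Bp.
(* Both alternatives reduce to this one, since [K] is contained in [Bplus C X]. *)
have [q Bq] : interior (Bplus C X) !=set0.
  by case: hint => // -[q Kq]; exists q; exact: interiorS Kq.
have /nbhs_ballP[r /= r0 qB] := Bq.
have [_ cC _] := hC; have [_ [clK _] _] := cvgK.
apply: (closed_approx clK) => e e0.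
(* The homothety of centre [p] and ratio [s] sends [q] to within [e] of [p], and the ball of radius
   [r] around [q] to one of radius [s * r]. The [+ 1] covers [p = q]. *)
pose s := Num.min 1 (e / (`|p - q| + 1)).
have d0 : 0 < `|p - q| + 1 by rewrite ltr_wpDl.
have s0 : 0 < s by rewrite lt_min ltr01 divr_gt0.
have s1 : s <= 1 by rewrite ge_min lexx.
exists (s *: q + (1 - s) *: p); last first.
  have -> : p - (s *: q + (1 - s) *: p) = s *: (p - q).
    by apply/rowP => j; rewrite !mxE; ring.
  rewrite normrZ gtr0_norm//.
  apply: (@lt_le_trans _ _ (s * (`|p - q| + 1))).
    by rewrite ltr_pM2l// ltrDl.
  by rewrite -ler_pdivlMr// ge_min lexx orbT.
apply: (inner_Bplus_lim cvgC cvgX cvgK hC_ (mulr_gt0 s0 r0)) => x w Xx xw.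
(* Undoing the homothety: [u + x] falls in the ball of radius [r] around [q], so [u] is in [C], and
   [w] is a convex combination of [u] and [p - x]. *)
pose u := s^-1 *: (w - (1 - s) *: (p - x)).
have -> : w = s *: u + (1 - s) *: (p - x).
  by rewrite scalerA divff ?gt_eqF// scale1r subrK.
apply: convex_setP => //; [by rewrite ltW|  |exact: Bp].
have /BplusP/(_ x Xx) : Bplus C X (u + x); last by rewrite addrK.
apply: qB; rewrite -ball_normE /=.
have -> : q - (u + x) = s^-1 *: (s *: q + (1 - s) *: p - x - w).
  by apply/rowP => j; rewrite !mxE; field; rewrite gt_eqF.
by rewrite normrZ gtr0_norm ?invr_gt0// mulrC ltr_pdivrMr// mulrC.
Qed.
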